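(* Let $n$ be a positive integer and let $G$ be a simple graph. Then $G$ is isomorphic to the quadrilateral book graph $B_{n,2}$ if and only if all of the following hold: $$[x]\,da(G;x,y) = 2y^{n+1} + 2n\,y^{2n},$$ $$[x^{2}]\,da(G;x,y) = n\,y^{2n+2} + (2n+1)y^{n+3},$$ $$[x^{2n+1}]\,da(G;x,y) = (2n+2)y^{2n+2},$$ $$[x^{2n+2}]\,da(G;x,y) = y^{2n+4}.$$
   Context: All graphs are finite, simple and have at least one vertex. For a graph $G$, $S\subseteq V(G)$ and $u\in V(G)$, let $\bar S=V(G)\setminus S$, let $\delta_S(u)=|\{v\in S:\{u,v\}\in E(G)\}|$, and let $G[S]$ be the subgraph induced by $S$. The defensive alliance polynomial of $G$ is $$da(G;x,y)=\sum_{S} x^{|S|}\,y^{f_y(S)},\qquad f_y(S)=\min_{u\in S}\bigl(\delta_S(u)-\delta_{\bar S}(u)+|V(G)|\bigr),$$ where the sum runs over all non-empty $S\subseteq V(G)$ such that $G[S]$ is connected (single-vertex graphs are connected). $[x^k]\,da(G;x,y)$ denotes the coefficient of $x^k$ in $da(G;x,y)$, which is a polynomial in $y$. The quadrilateral book graph $B_{n,2}$ has the $2n+2$ vertices $v_a,v_b,v_{1a},v_{1b},\dots,v_{na},v_{nb}$ and the $3n+1$ edges $\{v_a,v_b\}$ and, for each $1\le i\le n$, $\{v_a,v_{ia}\}$, $\{v_{ia},v_{ib}\}$, $\{v_{ib},v_b\}$ (that is, $n$ four-cycles sharing the common edge $\{v_a,v_b\}$). *)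

(* Defs.v *)
From HB Require Import structures.
From mathcomp Require Import all_boot all_order all_algebra.

Set Implicit Arguments.
Unset Strict Implicit.
Unset Printing Implicit Defensive.

Import GRing.Theory.

Record sgraph := SGraph {
  vertex :> finType;
  adj : rel vertex;
  adj_sym : symmetric adj;
  adj_irr : irreflexive adj
}.

Definition isomorphic (G H : sgraph) : Prop :=
  exists f : G -> H, bijective f /\ forall u v : G, adj (f u) (f v) = adj u v.

Section Induced.
Variables (G : sgraph) (S : {set G}).

Definition induced_adj : rel {u : G | u \in S} :=
  fun u v => adj (val u) (val v).

Lemma induced_adj_sym : symmetric induced_adj.
Proof. by move=> u v; rewrite /induced_adj adj_sym. Qed.

Lemma induced_adj_irr : irreflexive induced_adj.
Proof. by move=> u; rewrite /induced_adj adj_irr. Qed.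

Definition induced : sgraph := SGraph induced_adj_sym induced_adj_irr.
End Induced.

(* Holds vacuously for the graph with no vertex. *)
Definition connected (G : sgraph) : bool :=
  [forall u : G, forall v : G, connect (@adj G) u v].

Definition delta (G : sgraph) (S : {set G}) (u : G) : nat :=
  #|[set v in S | adj u v]|.

(* The integer delta_S(u) - delta_{~S}(u) + |V(G)| as a natural number: the
   subtraction is never truncated since delta_{~S}(u) <= |V(G)|. *)
Definition fy_at (G : sgraph) (S : {set G}) (u : G) : nat :=
  (delta S u + #|G|) - delta (~: S) u.

(* The default value 2 |V(G)| of the iterated minimum bounds every fy_at S u,
   so that for S nonempty this is the minimum over S; see fyP. *)
Definition fy (G : sgraph) (S : {set G}) : nat :=
  \big[minn/(2 * #|G|)%N]_(u in S) fy_at S u.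

Lemma delta_le (G : sgraph) (S : {set G}) (u : G) : delta S u <= #|G|.
Proof. exact: max_card. Qed.

Lemma fy_atE (G : sgraph) (S : {set G}) (u : G) :
  ((fy_at S u)%:Z = (delta S u)%:Z - (delta (~: S) u)%:Z + #|G|%:Z)%R.
Proof.
rewrite /fy_at -subzn; last exact: leq_trans (delta_le _ _) (leq_addl _ _).
by rewrite PoszD addrAC.
Qed.

Lemma fyP (G : sgraph) (S : {set G}) : S != set0 ->
  (exists2 u, u \in S & fy S = fy_at S u) /\
  (forall u, u \in S -> fy S <= fy_at S u).
Proof.
move=> S0.
have le_fy u : u \in S -> fy S <= fy_at S u.
  move=> uS; rewrite /fy; have := mem_index_enum u.
  elim: (index_enum _) => //= a r IHr; rewrite inE big_cons.
  case: eqVneq => [<- _|_ /= /IHr le_r]; first by rewrite uS geq_minl.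
  by case: (a \in S); rewrite // geq_min le_r orbT.
split=> //; have [u0 u0S] := set0Pn _ S0.
have : (exists2 u, u \in S & fy S = fy_at S u) \/ fy S = (2 * #|G|)%N.
  rewrite /fy; elim/big_ind: _ => [|x y Hx Hy|u uS]; first by right.
  - by rewrite /minn; case: ifP.
  - by left; exists u.
case=> // fyE.
exists u0 => //; apply/eqP; rewrite eqn_leq le_fy //= fyE mul2n -addnn.
by apply: leq_trans (leq_subr _ _) _; rewrite leq_add2r delta_le.
Qed.

Section Polynomial.
Local Open Scope ring_scope.

(* The outer variable is x and the inner one is y, so that (da G)`_k is the
   coefficient of x^k, as a polynomial in y. *)
Definition da (G : sgraph) : {poly {poly int}} :=
  \sum_(S : {set G} | (S != set0) && connected (induced S))
    ('X^(fy S))%:P * 'X^#|S|.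
End Polynomial.

(* inl false is v_a, inl true is v_b, and for i : 'I_n, inr (i, false) is
   v_{(i+1)a} and inr (i, true) is v_{(i+1)b}. *)
Definition book_vertex (n : nat) : finType := (bool + 'I_n * bool)%type.

Definition book_adj (n : nat) : rel (book_vertex n) := fun u v =>
  match u, v with
  | inl s, inl t => s != t
  | inl s, inr (_, t) => s == t
  | inr (_, s), inl t => s == t
  | inr (i, s), inr (j, t) => (i == j) && (s != t)
  end.

Lemma book_adj_sym (n : nat) : symmetric (@book_adj n).
Proof.
move=> [s|[i s]] [t|[j t]] //=; last by rewrite eq_sym [s == t]eq_sym.
all: by rewrite eq_sym.
Qed.

Lemma book_adj_irr (n : nat) : irreflexive (@book_adj n).
Proof. by move=> [s|[i s]] /=; rewrite !eqxx. Qed.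

Definition book (n : nat) : sgraph :=
  SGraph (@book_adj_sym n) (@book_adj_irr n).

(* Main.v *)
Require Import Defs.
From HB Require Import structures.
From mathcomp Require Import all_boot all_order all_algebra.
From mathcomp Require Import zify.

(** The coefficients of x, x^2 and x^(|V|-1) are sums of monomials y^k indexed by
the vertices, the edges and the vertices w such that G - w is connected; since
[da] is invariant under isomorphism, the direct implication is a computation in
the book.  Conversely, the coefficient of x gives |V| = 2n+2 and the degrees:
for n = 1 the graph is 2-regular on four vertices, and for n >= 2 there are 2n
low vertices (of degree 2) and two hubs (of degree n+1).  The coefficient of
x^(2n+1) says that every G - w is connected and that every vertex has a low
neighbour; the coefficient of x^2 says that n edges join low vertices, so these
edges form a perfect matching of the low vertices.  Two matched vertices hang on
different hubs, as otherwise removing their common hub would disconnect them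
from the rest; hence each hub has n low neighbours, and the hubs are adjacent. *)

Set Implicit Arguments.
Unset Strict Implicit.
Unset Printing Implicit Defensive.

Import GRing.Theory.

(** * Degrees, and connectivity through closed vertex sets *)

Definition deg (G : sgraph) (u : G) : nat := #|[set v | adj u v]|.

(** Replaces paths in the subtype by vertex sets closed under adjacency in [S]. Such a set
    propagates along any path; conversely, the vertices reachable from a given one form such a
    set. *)
Lemma connected_inducedP (G : sgraph) (S : {set G}) :
  reflect (forall T : {set G}, T \subset S -> T != set0 ->
             {in T & S, forall u v, adj u v -> v \in T} -> S \subset T)
          (connected (induced S)).
Proof.
apply: (iffP idP) => [conS T sTS /set0Pn[r rT] clT|closedS].
  apply/subsetP => u uS; have rS := subsetP sTS r rT.
  move/forallP/(_ (exist _ r rS))/forallP/(_ (exist _ u uS)): conS.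
  case/connectP=> p pth uE.
  suff all_T (x : induced S) q : val x \in T -> path (@adj (induced S)) x q ->
      val (last x q) \in T
    by have := all_T (exist _ r rS) p rT pth; rewrite -uE.
  elim: q x => //= y q IHq x xT /andP[xy pthq].
  by apply: IHq pthq; apply: clT xT (valP y) xy.
apply/forallP => x; apply/forallP => y.
pose T := [set val z | z : induced S & connect (@adj (induced S)) x z].
have sST : S \subset T.
  apply: closedS.
  - by apply/subsetP => _ /imsetP[z _ ->]; apply: valP.
  - by apply/set0Pn; exists (val x); apply: imset_f; rewrite inE.
  move=> u v /imsetP[z + ->] vS zv; rewrite inE => xz.
  apply/imsetP; exists (exist _ v vS : induced S) => //; rewrite inE.
  by apply: connect_trans xz (connect1 _).
by have /imsetP[z] := subsetP sST _ (valP y); rewrite inE => xz /val_inj ->.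
Qed.

(** Only closed sets containing a root need testing: by symmetry of adjacency, the complement in [S]
    of a closed set is closed too. *)
Lemma connected_from (G : sgraph) (S : {set G}) (r : G) : r \in S ->
  (forall T : {set G}, r \in T ->
     {in T & S, forall u v, adj u v -> v \in T} -> S \subset T) ->
  connected (induced S).
Proof.
move=> rS reach; apply/connected_inducedP => T sTS T0 clT.
case: (boolP (r \in T)) => [/reach|rT]; first exact.
have : S \subset S :\: T.
  apply: reach; first by rewrite inE rT.
  move=> u v; rewrite !inE => /andP[uT uS] vS uv; rewrite vS andbT.
  by apply: contra uT => vT; apply: clT vT uS _; rewrite adj_sym.
have [t tT] := set0Pn _ T0.
by move/subsetP/(_ _ (subsetP sTS _ tT)); rewrite inE tT.
Qed.

Lemma delta_split (G : sgraph) (S : {set G}) (u : G) :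
  delta S u + delta (~: S) u = deg u.
Proof.
rewrite /delta /deg -(cardsID S [set v | adj u v]).
by congr (_ + _); apply: eq_card => v; rewrite !inE andbC.
Qed.

Lemma deg_lt (G : sgraph) (u : G) : deg u < #|G|.
Proof.
rewrite /deg -cardsT; apply: proper_card; apply/properP; split.
  exact: subsetT.
by exists u; rewrite ?inE ?adj_irr.
Qed.

(** * Alliance values and connectivity of small and of large sets *)

Lemma fy_eq (G : sgraph) (S : {set G}) (u : G) (k : nat) : u \in S ->
  fy_at S u = k -> {in S, forall v, k <= fy_at S v} -> fy S = k.
Proof.
move=> uS fu lek; have S0 : S != set0 by apply/set0Pn; exists u.
have [[v vS fv] lef] := fyP S0; apply/eqP.
by rewrite eqn_leq -{1}fu lef //= fv lek.
Qed.

Lemma delta1 (G : sgraph) (u v : G) : delta [set v] u = adj u v.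
Proof.
rewrite /delta; case: (boolP (adj u v)) => uv.
  rewrite (_ : [set _ in _ | _] = [set v]) ?cards1 //.
  by apply/setP => w; rewrite !inE; case: eqVneq => // ->.
apply/eqP; rewrite cards_eq0; apply/eqP/setP => w; rewrite !inE.
by case: eqVneq => // ->; apply/negbTE.
Qed.

Lemma fy_set1 (G : sgraph) (u : G) : fy [set u] = #|G| - deg u.
Proof.
have fE : fy_at [set u] u = #|G| - deg u.
  by rewrite /fy_at -(delta_split [set u]) delta1 adj_irr.
by apply: (fy_eq _ fE) => [|v]; rewrite inE // => /eqP ->; rewrite fE.
Qed.

(** Each endpoint [w] has one neighbour inside and [deg w - 1] outside, so the minimum is reached at
    the endpoint of larger degree. *)
Lemma fy_set2 (G : sgraph) (u v : G) : adj u v ->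
  fy [set u; v] = #|G| + 2 - maxn (deg u) (deg v).
Proof.
move=> uv; have nuv : u != v by apply: contraTneq uv => ->; rewrite adj_irr.
have fE (w w' : G) : adj w w' -> fy_at [set w; w'] w = #|G| + 2 - deg w.
  move=> ww'; have := deg_lt w; rewrite /fy_at -(delta_split [set w; w']).
  have -> : delta [set w; w'] w = 1; last by lia.
  rewrite -[RHS]/(nat_of_bool true) -ww' -delta1; apply: eq_card => z.
  by rewrite !inE; case: eqVneq => //= ->; rewrite adj_irr andbF.
have fu := fE _ _ uv; have := fE v u; rewrite adj_sym setUC => /(_ uv) fv.
have [le_uv|lt_vu] := leqP (deg u) (deg v).
  apply: (fy_eq (u := v)); rewrite ?inE ?eqxx ?orbT //.
  by move=> w /set2P[] ->; rewrite ?fu ?fv; lia.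
apply: (fy_eq (u := u)); rewrite ?inE ?eqxx ?orbT //.
by move=> w /set2P[] ->; rewrite ?fu ?fv; lia.
Qed.

(** An edge from [u] to [w] counts twice: it is lost inside and gained outside. *)
Lemma fy_at_setC1 (G : sgraph) (w u : G) :
  fy_at [set~ w] u = #|G| + deg u - (adj u w).*2.
Proof.
have := deg_lt u; rewrite /fy_at -(delta_split [set~ w]) setCK delta1; lia.
Qed.

Lemma fy_at_setT (G : sgraph) (u : G) : fy_at [set: G] u = #|G| + deg u.
Proof.
rewrite /fy_at -(delta_split setT) setCT.
have -> : delta set0 u = 0; last by lia.
by apply/eqP; rewrite cards_eq0; apply/eqP/setP => v; rewrite !inE.
Qed.

Lemma connected_set1 (G : sgraph) (u : G) : connected (induced [set u]).
Proof. by apply: (connected_from (r := u)) => [|T]; rewrite ?sub1set ?inE. Qed.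

Lemma connected_set2 (G : sgraph) (u v : G) : u != v ->
  connected (induced [set u; v]) = adj u v.
Proof.
move=> nuv; apply/idP/idP => [/connected_inducedP cuv|uv].
  apply: contraT => Nuv.
  have /subsetP/(_ v) : [set u; v] \subset [set u].
    apply: cuv.
    - exact: subsetUl.
    - by apply/set0Pn; exists u; rewrite inE.
    move=> x y; rewrite !inE => /eqP -> /orP[] // /eqP -> uv.
    by rewrite uv in Nuv.
  by rewrite !inE eqxx orbT eq_sym (negbTE nuv) => /(_ isT).
apply: (connected_from (r := u)) => [|T uT clT]; first by rewrite !inE eqxx.
apply/subsetP => w /set2P[] -> //.
by apply: clT uT _ uv; rewrite !inE eqxx orbT.
Qed.

(** * Coefficients of [da] as sums of monomials in y *)

Local Open Scope ring_scope.

Lemma coef_da (G : sgraph) (k : nat) :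
  (da G)`_k =
    \sum_(S : {set G} | [&& S != set0, connected (induced S) & #|S| == k])
      'X^(fy S).
Proof.
rewrite /da coef_sum; under eq_bigr => S _ do rewrite coefCM coefXn.
rewrite [RHS](eq_bigl (fun S : {set G} =>
  ((S != set0) && connected (induced S)) && (#|S| == k))); last first.
  by move=> S; rewrite andbA.
rewrite [RHS]big_mkcondr; apply: eq_bigr => S _; rewrite eq_sym.
by case: eqP => _; rewrite ?mulr1 ?mulr0.
Qed.

Lemma coef1_da (G : sgraph) : (da G)`_1 = \sum_(u : G) 'X^(#|G| - deg u).
Proof.
rewrite coef_da (eq_bigl (mem [set [set u] | u in [set: G]])); last first.
  move=> S; apply/and3P/imsetP => [[_ _ /cards1P[u ->]]|[u _ ->]].
    by exists u.
  by rewrite connected_set1 cards1; split=> //; apply/set0Pn; exists u; rewrite inE.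
rewrite big_imset /=; last by move=> u v _ _; apply: set1_inj.
by apply: eq_big => [u|u _]; rewrite ?inE ?fy_set1.
Qed.

(* Summing over ordered pairs counts every edge twice. *)
Lemma coef2_da (G : sgraph) :
  (da G)`_2 *+ 2 = \sum_(e : G * G | adj e.1 e.2)
                     'X^(#|G| + 2 - maxn (deg e.1) (deg e.2)).
Proof.
rewrite coef_da -sumrMnl.
rewrite [RHS](partition_big (fun e : G * G => [set e.1; e.2])
   (fun S : {set G} => [&& S != set0, connected (induced S) & #|S| == 2])) /=.
  apply: eq_bigr => S /and3P[_ conS /cards2P[u [v [nuv defS]]]].
  have uv : adj u v by rewrite -connected_set2 // -defS.
  rewrite (eq_bigl (pred2 (u, v) (v, u))); last first.
    move=> [x y] /=; rewrite defS !xpair_eqE; apply/andP/orP => [[xy /eqP eS]|].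
      have : x \in [set u; v] by rewrite -eS !inE eqxx.
      have : y \in [set u; v] by rewrite -eS !inE eqxx orbT.
      have nxy : x != y by apply: contraTneq xy => ->; rewrite adj_irr.
      move=> /set2P[] yE /set2P[] xE; rewrite xE yE ?eqxx; auto.
        by rewrite xE yE eqxx in nxy.
      by rewrite xE yE eqxx in nxy.
    by case=> /andP[/eqP-> /eqP->]; rewrite 1?[adj v u]adj_sym 1?[[set v; u]]setUC.
  rewrite (bigD1 (u, v)) ?inE ?eqxx //= (big_pred1 (v, u)) => [|[x y]].
    by rewrite /= [maxn (deg v) _]maxnC defS fy_set2.
  rewrite /= !xpair_eqE; case: (eqVneq x u) => [->|]; case: (eqVneq y v) => [->|];
    by rewrite ?(negbTE nuv) ?orbF ?andbT ?andbF.
move=> [u v] /= uv; have nuv : u != v by apply: contraTneq uv => ->; rewrite adj_irr.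
rewrite connected_set2 // uv cards2 nuv eqxx !andbT.
by apply/set0Pn; exists u; rewrite !inE eqxx.
Qed.

(** The sets with one vertex less than the graph are the complements of single vertices. *)
Lemma coef_pred_da (G : sgraph) : (1 < #|G|)%N ->
  (da G)`_(#|G|.-1) =
    \sum_(w : G | connected (induced [set~ w])) 'X^(fy [set~ w]).
Proof.
move=> G_gt1; rewrite coef_da.
rewrite (eq_bigl (mem [set [set~ w] | w in [pred w | connected (induced [set~ w])]])).
  rewrite big_imset /=; last by move=> u v _ _ /= /setC_inj/set1_inj.
  by apply: eq_bigl => w; rewrite !inE.
move=> S; apply/and3P/imsetP => [[_ conS cardS]|[w]].
  have /cards1P[w defS] : #|~: S| == 1.
    by move: cardS; have := cardsC S; lia.
  by exists w; rewrite ?inE -defS setCK.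
rewrite inE => conw ->; have cw : #|[set~ w]| = #|G|.-1 by rewrite cardsC1.
by rewrite cw; split=> //; rewrite -cards_eq0 cw; lia.
Qed.

Lemma coef_card_da (G : sgraph) : (0 < #|G|)%N -> connected (induced [set: G]) ->
  (da G)`_(#|G|) = 'X^(fy [set: G]).
Proof.
move=> G_gt0 conG; rewrite coef_da (big_pred1 setT) // => S.
apply/and3P/eqP => [[_ _ cardS]|->].
  by apply/eqP; rewrite eqEcard subsetT cardsT (eqP cardS) leqnn.
by rewrite cardsT -cards_eq0 cardsT; split=> //; lia.
Qed.

(** Turns an equality between polynomials in y into a count of the indices with a prescribed
    exponent. *)
Lemma coef_sumXn (I : finType) (P : pred I) (f : I -> nat) (k : nat) :
  (\sum_(i | P i) 'X^(f i) : {poly int})`_k = #|[set i | P i & f i == k]|%:R.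
Proof.
rewrite coef_sum; under eq_bigr => i _ do rewrite coefXn.
rewrite -sum1_card natr_sum big_mkcond [RHS]big_mkcond /=.
by apply: eq_bigr => i _; rewrite inE eq_sym; case: (P i) => //; case: eqP.
Qed.

Lemma horner1_sumXn (I : finType) (P : pred I) (f : I -> nat) :
  (\sum_(i | P i) 'X^(f i) : {poly int}).[1] = #|[set i | P i]|%:R.
Proof.
rewrite horner_sum; under eq_bigr => i _ do rewrite hornerXn expr1n.
by rewrite sumr_const; congr (_ *+ _); apply: eq_card => i; rewrite !inE.
Qed.

(** * Invariance of [da] under isomorphism *)

Section Isomorphism.
Variables (G H : sgraph) (f : G -> H).
Hypotheses (bij_f : bijective f) (adj_f : forall u v, adj (f u) (f v) = adj u v).

Let inj_f : injective f := bij_inj bij_f.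

Lemma card_iso : #|G| = #|H|.
Proof. exact: bij_eq_card bij_f. Qed.

Lemma delta_iso (S : {set G}) (u : G) : delta (f @: S) (f u) = delta S u.
Proof.
rewrite /delta -(card_imset _ inj_f); apply: eq_card => w; rewrite !inE.
apply/andP/imsetP => [[/imsetP[v vS ->] uv]|[v]].
  by exists v; rewrite // inE vS -adj_f.
by rewrite inE => /andP[vS uv] ->; rewrite mem_imset // adj_f.
Qed.

Lemma fy_at_iso (S : {set G}) (u : G) : fy_at (f @: S) (f u) = fy_at S u.
Proof.
have fC : ~: (f @: S) = f @: (~: S).
  apply/setP => w; have [g _ fK] := bij_f.
  by rewrite -[w]fK inE !(mem_imset _ _ inj_f) inE.
by rewrite /fy_at fC !delta_iso card_iso.
Qed.

Lemma fy_iso (S : {set G}) : S != set0 -> fy (f @: S) = fy S.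
Proof.
move=> /fyP[[u uS fu] lef]; apply: (fy_eq (u := f u)).
- exact: imset_f.
- by rewrite fy_at_iso.
by move=> _ /imsetP[v vS ->]; rewrite fy_at_iso lef.
Qed.

Lemma connected_induced_iso (S : {set G}) :
  connected (induced S) -> connected (induced (f @: S)).
Proof.
move=> /connected_inducedP conS; apply/connected_inducedP => T sT /set0Pn[t tT] clT.
have sST : S \subset f @^-1: T.
  apply: conS.
  - by apply/subsetP => u; rewrite inE => /(subsetP sT); rewrite mem_imset.
  - have /imsetP[u _ tE] := subsetP sT t tT.
    by apply/set0Pn; exists u; rewrite inE -tE.
  move=> u v; rewrite !inE => uT vS uv.
  by apply: clT uT _ _; rewrite ?adj_f ?imset_f.
by apply/subsetP => _ /imsetP[u uS ->]; have := subsetP sST u uS; rewrite inE.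
Qed.

End Isomorphism.

Lemma da_iso (G H : sgraph) : isomorphic G H -> da G = da H.
Proof.
case=> f [bij_f adj_f]; have inj_f := bij_inj bij_f.
have [g fK gK] := bij_f.
have adj_g u v : adj (g u) (g v) = adj u v by rewrite -adj_f !gK.
have bij_g : bijective g by exists f.
rewrite /da [RHS](reindex (fun S : {set G} => f @: S)) /=; last first.
  exists (fun T : {set H} => g @: T) => T _.
    by rewrite -imset_comp -[RHS]imset_id; apply: eq_imset => u /=; rewrite fK.
  by rewrite -imset_comp -[RHS]imset_id; apply: eq_imset => u /=; rewrite gK.
apply: eq_big => [S|S /andP[S0 _]]; last by rewrite fy_iso // card_imset.
rewrite -!cards_eq0 card_imset //; congr (_ && _); apply/idP/idP.
  exact: connected_induced_iso.
move/(connected_induced_iso bij_g adj_g); rewrite -imset_comp.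
by rewrite (_ : (g \o f) @: S = S) // -[RHS]imset_id; apply: eq_imset => u /=; rewrite fK.
Qed.

(** * The four coefficients of the book *)

Lemma sum_bookE (R : nmodType) (n : nat) (F : book n -> R) :
  \sum_u F u = \sum_(s : bool) F (inl s) +
               \sum_(i : 'I_n) \sum_(s : bool) F (inr (i, s)).
Proof.
rewrite big_sumType /=; congr (_ + _).
by rewrite (pair_bigA _ (fun i s => F (inr (i, s)))); apply: eq_bigr => -[i s].
Qed.

Lemma card_book (n : nat) : #|book n| = (2 * n + 2)%N.
Proof. by rewrite card_sum card_prod card_ord card_bool; lia. Qed.

(** The summand is arbitrary so as to serve both the degrees, with summand 1, and the sum over the
    edges. *)
Lemma sum_adj_hub (R : nmodType) (n : nat) (s : bool) (F : book n -> R) :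
  \sum_(v | adj (inl s : book n) v) F v =
  F (inl (~~ s)) + \sum_(i : 'I_n) F (inr (i, s)).
Proof.
rewrite big_mkcond sum_bookE /=; congr (_ + _).
  by case: s; rewrite big_bool /= ?addr0 ?add0r.
by apply: eq_bigr => i _; case: s; rewrite big_bool /= ?addr0 ?add0r.
Qed.

Lemma sum_adj_page (R : nmodType) (n : nat) (i : 'I_n) (s : bool) (F : book n -> R) :
  \sum_(v | adj (inr (i, s) : book n) v) F v = F (inl s) + F (inr (i, ~~ s)).
Proof.
rewrite big_mkcond sum_bookE /=; congr (_ + _).
  by case: s; rewrite big_bool /= ?addr0 ?add0r.
rewrite (bigD1 i) //= [X in _ + X]big1 => [|j ji]; last first.
  by rewrite eq_sym (negbTE ji) big_bool /= addr0.
by rewrite eqxx addr0; case: s; rewrite big_bool /= ?addr0 ?add0r.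
Qed.

Lemma deg_sum (G : sgraph) (u : G) : deg u = \sum_(v | adj u v) 1.
Proof. by rewrite /deg -sum1_card; apply: eq_bigl => v; rewrite inE. Qed.

Lemma deg_hub (n : nat) (s : bool) : deg (inl s : book n) = n.+1.
Proof.
by rewrite deg_sum sum_adj_hub sumr_const card_ord; lia.
Qed.

Lemma deg_page (n : nat) (p : 'I_n * bool) : deg (inr p : book n) = 2.
Proof. by case: p => i s; rewrite deg_sum sum_adj_page. Qed.

Lemma coef1_book (n : nat) :
  (da (book n))`_1 = 2%:R *: 'X^(n + 1) + (2 * n)%:R *: 'X^(2 * n).
Proof.
rewrite coef1_da sum_bookE big_bool.
under eq_bigr => i _ do rewrite big_bool /= !deg_page.
rewrite /= !deg_hub sumr_const card_ord card_book.
have -> : (2 * n + 2 - n.+1 = n + 1)%N by lia.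
rewrite addnK !scaler_nat -!mulr2n mulrnA; done.
Qed.

Lemma coef2_book (n : nat) : (0 < n)%N ->
  (da (book n))`_2 = n%:R *: 'X^(2 * n + 2) + (2 * n + 1)%:R *: 'X^(n + 3).
Proof.
move=> n_gt0; have := coef2_da (book n).
rewrite -(pair_big_dep xpredT (fun u v => adj u v)
  (fun u v : book n => 'X^(#|book n| + 2 - maxn (deg u) (deg v)))) /=.
rewrite sum_bookE big_bool.
under [X in _ + X]eq_bigr => i _.
  rewrite big_bool /= !sum_adj_page /= !deg_page !deg_hub.
  over.
rewrite !sum_adj_hub /= !deg_hub.
under [\sum_(i < n) 'X^(_ - maxn n.+1 _)]eq_bigr do rewrite deg_page.
under [X in _ + (_ + X) + _]eq_bigr do rewrite deg_page.
rewrite !sumr_const !card_ord card_book.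
have -> : maxn 2 n.+1 = n.+1 by lia.
have -> : maxn n.+1 2 = n.+1 by lia.
rewrite !maxnn.
have -> : (2 * n + 2 + 2 - n.+1 = n + 3)%N by lia.
have -> : (2 * n + 2 + 2 - 2 = 2 * n + 2)%N by lia.
(* The equation at hand is twice the desired one; the factor 2 is cancelled coefficient by
   coefficient, over the integers. *)
move=> /polyP eq2; apply/polyP => k; move: (eq2 k).
rewrite !(coefMn, coefD, coefZ); move: ('X^(n + 3))`_k ('X^(2 * n + 2))`_k.
move=> a b. lia.
Qed.

(** A surviving hub [inl s] reaches its own side of the pages directly. The opposite side is reached
    through the other hub or, if that is the removed vertex, through the page edges. *)
Lemma connected_book_setC1 (n : nat) (w : book n) : connected (induced [set~ w]).
Proof.
have [s nw] : exists s, inl s != w.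
  by case: w => [s|p]; [exists (~~ s); case: s | exists true].
apply: (connected_from (G := book n) (r := inl s)) => [|T sT clT]; first by rewrite !inE.
have step u v : u \in T -> v != w -> adj u v -> v \in T.
  by move=> uT vw; apply: clT uT _; rewrite !inE.
have sideT i : inr (i, s) != w -> inr (i, s) \in T.
  by move=> iw; apply: step sT iw _; rewrite /= eqxx.
have hubT : inl (~~ s) != w -> inl (~~ s) \in T.
  by move=> iw; apply: step sT iw _; rewrite /=; case: (s).
have notE t : t != s -> t = ~~ s by case: t; case: (s).
apply/subsetP => -[t|[i t]]; rewrite !inE.
  by case: (eqVneq t s) => [-> //|/notE ->].
case: (eqVneq t s) => [-> /sideT //|/notE -> iw].
case: (eqVneq (inl (~~ s)) w) => [wE|/hubT hT].
  have iT : inr (i, s) \in T by apply: sideT; rewrite -wE.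
  by apply: step iT iw _; rewrite /= eqxx; case: (s).
by apply: step hT iw _; rewrite /= eqxx.
Qed.

Lemma deg_book_ge2 (n : nat) (u : book n) : (0 < n)%N -> (2 <= deg u)%N.
Proof. by case: u => [s|p]; rewrite ?deg_hub ?deg_page. Qed.

(** Every vertex [w] has a page neighbour, of degree 2, which attains the value; no vertex goes
    below it, since all degrees are at least 2. *)
Lemma fy_book_setC1 (n : nat) (w : book n) : (0 < n)%N ->
  fy [set~ w] = (2 * n + 2)%N.
Proof.
move=> n_gt0.
have [p wp] : exists p, adj (inr p : book n) w.
  case: w => [s|[i s]]; first by exists (Ordinal n_gt0, s); rewrite /= eqxx.
  by exists (i, ~~ s); rewrite /= eqxx; case: s.
apply: (fy_eq (G := book n) (u := inr p)).
- by rewrite !inE; apply: contraTneq wp => ->; rewrite adj_irr.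
- by rewrite fy_at_setC1 wp deg_page card_book; lia.
move=> v _; rewrite fy_at_setC1 card_book.
by have := deg_book_ge2 v n_gt0; case: (adj v w); lia.
Qed.

Lemma connected_book (n : nat) : connected (induced [set: book n]).
Proof.
apply: (connected_from (G := book n) (r := inl true)) => [|T rT clT]; first by rewrite inE.
have step u v : u \in T -> adj u v -> v \in T by move=> uT; apply: clT.
have hubT s : inl s \in T by case: s => //; apply: step rT _.
by apply/subsetP => -[s|[i s]] _ //; apply: step (hubT s) _; rewrite /= eqxx.
Qed.

Lemma fy_book_setT (n : nat) : (0 < n)%N -> fy [set: book n] = (2 * n + 4)%N.
Proof.
move=> n_gt0; apply: (fy_eq (G := book n) (u := inr (Ordinal n_gt0, true))).
- by rewrite inE.
- by rewrite fy_at_setT deg_page card_book; lia.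
by move=> v _; rewrite fy_at_setT card_book; have := deg_book_ge2 v n_gt0; lia.
Qed.

Lemma coef_pred_book (n : nat) : (0 < n)%N ->
  (da (book n))`_(2 * n + 1) = (2 * n + 2)%:R *: 'X^(2 * n + 2).
Proof.
move=> n_gt0; have -> : (2 * n + 1 = #|book n|.-1)%N by rewrite card_book; lia.
rewrite coef_pred_da; last by rewrite card_book; lia.
rewrite (eq_bigl xpredT) => [|w]; last by rewrite connected_book_setC1.
under eq_bigr => w _ do rewrite fy_book_setC1 //.
by rewrite sumr_const card_book scaler_nat.
Qed.

Lemma coef_card_book (n : nat) : (0 < n)%N ->
  (da (book n))`_(2 * n + 2) = 'X^(2 * n + 4).
Proof.
move=> n_gt0; rewrite -card_book coef_card_da ?connected_book ?fy_book_setT //.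
by rewrite card_book; lia.
Qed.

(** * Building isomorphisms, and the book with one page *)

Lemma isomorphic_sym (G H : sgraph) : isomorphic G H -> isomorphic H G.
Proof.
case=> f [[g fK gK] adj_f]; exists g; split; first by exists f.
by move=> u v; rewrite -adj_f !gK.
Qed.

(* An injective homomorphism that does not increase degrees reflects edges. *)
Lemma isomorphic_of_hom (G H : sgraph) (f : H -> G) : injective f ->
  (#|G| <= #|H|)%N -> {homo f : u v / adj u v} ->
  (forall u, (deg (f u) <= deg u)%N) -> isomorphic G H.
Proof.
move=> inj_f leGH hom_f deg_f; apply: isomorphic_sym.
exists f; split=> [|u v]; first exact: inj_card_bij.
apply/idP/idP=> [fuv|]; last exact: hom_f.
have : f @: [set v | adj u v] == [set w | adj (f u) w].
  rewrite eqEcard (card_imset _ inj_f) deg_f andbT.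
  by apply/subsetP => _ /imsetP[w uw ->]; move: uw; rewrite !inE; apply: hom_f.
by move/eqP/setP/(_ (f v)); rewrite mem_imset // !inE fuv.
Qed.

(** If [b] and [c] are the neighbours of [a], the fourth vertex [d] is not adjacent to [a], so its
    two neighbours are again [b] and [c], and the graph is a four-cycle. *)
Lemma isomorphic_book1 (G : sgraph) : #|G| = 4 -> (forall u : G, deg u = 2) ->
  isomorphic G (book 1).
Proof.
move=> cardG degG.
have /card_gt0P[a _] : (0 < #|G|)%N by rewrite cardG.
have /eqP/cards2P[b [c [nbc Na]]] := degG a.
have ab : adj a b by have := set21 b c; rewrite -Na inE.
have ac : adj a c by have := set22 b c; rewrite -Na inE.
have nab : a != b by apply: contraTneq ab => ->; rewrite adj_irr.
have nac : a != c by apply: contraTneq ac => ->; rewrite adj_irr.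
have c3 : #|a |: [set b; c]| = 3 by rewrite cardsU1 cards2 !inE nbc negb_or nab nac.
have /card_gt0P[d] : (0 < #|~: (a |: [set b; c])|)%N.
  by have := cardsC (a |: [set b; c]); rewrite cardG c3; lia.
rewrite inE => nd; have c4 : d |: (a |: [set b; c]) = setT.
  by apply/eqP; rewrite eqEcard subsetT cardsT cardsU1 nd c3 cardG.
move: nd; rewrite !inE !negb_or => /and3P[nda ndb ndc].
have Nd : [set v | adj d v] = [set b; c].
  apply/eqP; rewrite eqEcard cards2 nbc -/(deg d) degG andbT; apply/subsetP => v.
  have := in_setT v; rewrite -c4 !inE => /or3P[/eqP->|/eqP->|//].
    by rewrite adj_irr.
  rewrite adj_sym => ad; have : d \in [set b; c] by rewrite -Na inE.
  by rewrite !inE (negbTE ndb) (negbTE ndc).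
have db : adj d b by have := set21 b c; rewrite -Nd inE.
have dc : adj d c by have := set22 b c; rewrite -Nd inE.
(* The cycle a, b, d, c is read as v_a, v_b, v_1b, v_1a. *)
pose f (u : book 1) : G :=
  match u with
  | inl s => if s then b else a
  | inr (_, s) => if s then d else c
  end.
apply: (@isomorphic_of_hom _ _ f).
- move=> [[]|[i []]] [[]|[j []]] //=; rewrite ?(ord1 i) ?(ord1 j) // => e;
    by move: nda ndb ndc nab nac nbc; rewrite e ?eqxx.
- by rewrite card_book cardG.
- by move=> [[]|[i []]] [[]|[j []]] //=; rewrite ?andbF // 1?adj_sym.
by move=> [s|p]; rewrite degG ?deg_hub ?deg_page.
Qed.

Lemma delta2 (G : sgraph) (u v w : G) : v != w ->
  delta [set v; w] u = (adj u v + adj u w)%N.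
Proof.
move=> nvw; rewrite -!delta1 /delta -cardsUI [X in (_ + X)%N]eq_card0 ?addn0.
  by apply: eq_card => x; rewrite !inE andb_orl.
by move=> x; rewrite !inE; case: (eqVneq x v) => [->|//]; rewrite (negbTE nvw) /= andbF.
Qed.

(** * Reconstruction of the book from the low vertices [L] and the hubs [h] *)

Section BookStructure.
Variables (n : nat) (G : sgraph) (L : {set G}) (h : bool -> G).
Hypotheses (inj_h : injective h) (defLC : ~: L = [set h true; h false]).
Hypotheses (cardL : #|L| = (2 * n)%N) (deg_h : forall s, deg (h s) = n.+1).
Hypotheses (degL : {in L, forall u, deg u = 2}).
Hypotheses (deltaL : {in L, forall u, delta L u = 1}).
Hypothesis connC : forall w : G, connected (induced [set~ w]).

Let hL s : h s \notin L.
Proof. by rewrite -in_setC defLC !inE; case: s; rewrite eqxx ?orbT. Qed.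

Let outL v : v \notin L -> exists s, v = h s.
Proof. by rewrite -in_setC defLC => /set2P[] ->; eexists. Qed.

Let h_neq s : h (~~ s) != h s.
Proof. by rewrite (inj_eq inj_h); case: s. Qed.

(** One of the two neighbours of [u] is low, so the other one is exactly one of the two hubs. *)
Let adj_h u s : u \in L -> adj u (h (~~ s)) = ~~ adj u (h s).
Proof.
move=> uL; have := delta_split L u; rewrite deltaL // degL // defLC.
rewrite delta2; last exact: (h_neq false).
by case: s => /=; case: (adj u _); case: (adj u _).
Qed.

Let mateP u : u \in L ->
  exists2 v, v \in L /\ adj u v & forall w, w \in L -> adj u w -> w = v.
Proof.
move=> /deltaL/eqP/cards1P[v /setP Nu]; exists v.
  by have := Nu v; rewrite !inE eqxx => /andP.
by move=> w wL uw; apply/eqP; have := Nu w; rewrite !inE wL uw.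
Qed.

(** The mate of [u], its unique low neighbour; for [u] in [L] the search succeeds by [deltaL]. *)
Let m u := odflt u [pick v in L | adj u v].

Let mL u : u \in L -> m u \in L.
Proof. by move=> uL; rewrite /m; case: pickP => //= v /andP[]. Qed.

Let adj_m u : u \in L -> adj u (m u).
Proof.
move=> uL; rewrite /m; case: pickP => [v /andP[]//|no].
by have [v [vL uv]] := mateP uL; have := no v; rewrite vL uv.
Qed.

Let m_uniq u v : u \in L -> v \in L -> adj u v -> v = m u.
Proof.
move=> uL vL uv; have [w _ uniq] := mateP uL.
by rewrite (uniq v) // (uniq (m u)) ?mL ?adj_m.
Qed.

Let mK u : u \in L -> m (m u) = u.
Proof.
by move=> uL; rewrite -(m_uniq (mL uL) uL) // adj_sym adj_m.
Qed.

(* Otherwise u and its mate would be cut off by the hub h s. *)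
Let mate_side u s : u \in L -> adj u (h s) -> ~~ adj (m u) (h s).
Proof.
move=> uL us; apply/negP => mus.
have neq_h v : v \in L -> v != h s by apply: contraTneq => ->.
have nbr v : v \in L -> adj v (h s) -> forall w, w != h s -> adj v w -> w = m v.
  move=> vL vs w ws vw; apply: m_uniq => //; apply/negPn/negP => /outL[t wE].
  move: ws vw; rewrite {}wE (inj_eq inj_h) => ts.
  have -> : t = ~~ s by case: t ts; case: (s).
  by rewrite adj_h // vs.
have sub : [set~ h s] \subset [set u; m u].
  move/connected_inducedP: (connC (h s)); apply.
  - by apply/subsetP => v /set2P[] ->; rewrite !inE neq_h ?mL.
  - by apply/set0Pn; exists u; rewrite set21.
  move=> v w /set2P[] -> /[!inE] ws vw.
    by rewrite (nbr _ uL us _ ws vw) eqxx orbT.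
  by rewrite (nbr _ (mL uL) mus _ ws vw) mK ?eqxx.
have := subsetP sub (h (~~ s)); rewrite !inE h_neq => /(_ isT) /orP[] /eqP hE.
  by have := hL (~~ s); rewrite hE uL.
by have := hL (~~ s); rewrite hE mL.
Qed.

(** Applying [mate_side] to [h s] gives one direction, and to the other hub the converse. *)
Let adj_m_h u s : u \in L -> adj (m u) (h s) = ~~ adj u (h s).
Proof.
move=> uL; case: (boolP (adj u (h s))) => [/(mate_side uL)/negbTE //|us].
have := mate_side (s := ~~ s) uL; rewrite !adj_h ?mL // us => /(_ isT).
by rewrite negbK.
Qed.

Let A := [set u in L | adj u (h false)].

(** Mating is an involution exchanging [A] with the rest of [L], so [A] is half of the 2n low
    vertices. *)
Let cardA : #|A| = n.
Proof.
have mA : m @: A = L :\: A.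
  apply/setP => v; rewrite !inE; apply/imsetP/andP => [[u]|[]].
    rewrite inE => /andP[uL uh] ->; rewrite mL // adj_m_h // uh; split=> //.
  move=> vA vL; exists (m v); rewrite ?mK // inE mL // adj_m_h //.
  by rewrite vL in vA.
have inj_m : {in A &, injective m}.
  move=> u v; rewrite !inE => /andP[uL _] /andP[vL _] muv.
  by rewrite -(mK uL) muv mK.
have AL : A \subset L by apply/subsetP => u; rewrite inE => /andP[].
have := cardsID A L; rewrite -mA card_in_imset // (setIidPr AL) cardL; lia.
Qed.

(** The low neighbours of [h false] form [A] and number n; its degree n+1 leaves one more neighbour,
    which must be the other hub. *)
Let adj_hh s : adj (h s) (h (~~ s)).
Proof.
have ab : adj (h false) (h true).
  have := delta_split L (h false); rewrite deg_h defLC delta2; last exact: (h_neq false).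
  rewrite adj_irr addn0; have -> : delta L (h false) = n; last first.
    by case: (adj _ _) => //; lia.
  by rewrite -[RHS]cardA; apply: eq_card => v; rewrite !inE adj_sym.
by case: s => //=; rewrite adj_sym.
Qed.

Let p (i : 'I_n) : G := enum_val (cast_ord (esym cardA) i).

Let pA i : p i \in A. Proof. exact: enum_valP. Qed.

Let pL i : p i \in L. Proof. by have := pA i; rewrite inE => /andP[]. Qed.

Let inj_p : injective p.
Proof. by move=> i j /enum_val_inj/cast_ord_inj. Qed.

(** Page i consists of the i-th element of [A], on the side of [h false], and its mate, on the side
    of [h true]. *)
Let q (x : 'I_n * bool) : G := if x.2 then m (p x.1) else p x.1.

Let qL x : q x \in L.
Proof. by case: x => i []; rewrite /q /= ?mL. Qed.

Let adj_qh i s : adj (q (i, s)) (h s).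
Proof.
have ph : adj (p i) (h false) by have := pA i; rewrite inE => /andP[].
by case: s; rewrite /q //= adj_m_h // (adj_h false) // ph.
Qed.

Let adj_qN i s : adj (q (i, s)) (q (i, ~~ s)).
Proof. by case: s; rewrite /q /= ?adj_m // adj_sym adj_m. Qed.

(** The hub adjacent to [q (i, s)] determines [s]; then i is recovered as [p] is injective and [m]
    is an involution on [L]. *)
Let inj_q : injective q.
Proof.
move=> [i s] [j t] eq_q; have st : s = t.
  have := adj_qh i s; rewrite eq_q; case: (eqVneq s t) => // nst.
  have -> : s = ~~ t by case: s t nst {eq_q} => [] [].
  by rewrite adj_h // adj_qh.
move: eq_q; rewrite {}st /q /=; case: t => [/(congr1 m)|/inj_p -> //].
by rewrite !mK // => /inj_p ->.
Qed.

Lemma isomorphic_book : isomorphic G (book n).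
Proof.
pose f (u : book n) : G := match u with inl s => h s | inr x => q x end.
apply: (@isomorphic_of_hom _ _ f).
- move=> [s|x] [t|y] /= => [/inj_h ->//|e|e|/inj_q ->//].
    by have := hL s; rewrite e qL.
  by have := hL t; rewrite -e qL.
- by rewrite card_book -(cardsC L) cardL defLC cards2 (h_neq false).
- move=> [s|[i s]] [t|[j t]] /=.
  + by move=> st; have -> : t = ~~ s by case: s t st => [] [].
  + by move/eqP ->; rewrite adj_sym.
  + by move/eqP ->.
  by case/andP => /eqP -> st; have -> : t = ~~ s by case: s t st => [] [].
by move=> [s|x]; rewrite ?deg_hub ?deg_page /= ?deg_h ?degL.
Qed.

End BookStructure.

(** * From the coefficients to the structure of the graph *)

(** Evaluation at y = 1 counts the vertices. *)
Lemma card_of_coef1 (n : nat) (G : sgraph) :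
  (da G)`_1 = 2%:R *: 'X^(n + 1) + (2 * n)%:R *: 'X^(2 * n) ->
  #|G| = (2 * n + 2)%N.
Proof.
rewrite coef1_da => /(congr1 (horner^~ 1)).
rewrite /= horner1_sumXn hornerD !hornerZ !hornerXn !expr1n cardsE.
have -> : #|(xpredT : pred G)| = #|G| by apply: eq_card.
lia.
Qed.

Lemma count_deg_of_coef1 (n : nat) (G : sgraph) (k : nat) :
  (da G)`_1 = 2%:R *: 'X^(n + 1) + (2 * n)%:R *: 'X^(2 * n) ->
  #|[set u : G | #|G| - deg u == k]%N| =
    (2 * (k == n + 1) + 2 * n * (k == 2 * n))%N.
Proof.
rewrite coef1_da => /(congr1 (fun p : {poly int} => p`_k)).
rewrite coef_sumXn coefD !coefZ !coefXn /=.
by case: eqP => _; case: eqP => _; lia.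
Qed.

Theorem proposition40 (n : nat) (G : sgraph) (n_gt0 : (0 < n)%N)
    (G_gt0 : (0 < #|G|)%N) :
  isomorphic G (book n) <->
  [/\ (da G)`_1 = 2%:R *: 'X^(n + 1) + (2 * n)%:R *: 'X^(2 * n),
      (da G)`_2 = n%:R *: 'X^(2 * n + 2) + (2 * n + 1)%:R *: 'X^(n + 3),
      (da G)`_(2 * n + 1) = (2 * n + 2)%:R *: 'X^(2 * n + 2) &
      (da G)`_(2 * n + 2) = 'X^(2 * n + 4)].
Proof.
split=> [/da_iso ->|[eq1 eq2 eq3 _]].
  by rewrite coef1_book coef2_book // coef_pred_book // coef_card_book.
have cardG := card_of_coef1 eq1.
have cnt k := count_deg_of_coef1 k eq1.
(* For n = 1 the exponents n+1 and 2n coincide, so degrees cannot tell hubs from low vertices. *)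
have [n1|n_neq1] := eqVneq n 1.
  rewrite {}n1 in cardG cnt *; apply: isomorphic_book1 => // u.
  have := cnt 2; rewrite /= => c4.
  have : [set u : G | #|G| - deg u == 2]%N = setT.
    by apply/eqP; rewrite eqEcard subsetT cardsT c4 cardG.
  move/setP/(_ u); rewrite !inE cardG; have := deg_lt u; lia.
have n_gt1 : (1 < n)%N by lia.
pose L := [set u : G | deg u == 2].
have cardL : #|L| = (2 * n)%N.
  have := cnt (2 * n)%N; rewrite eqxx; have -> : (2 * n == n + 1)%N = false by lia.
  rewrite muln0 muln1 add0n => <-; apply: eq_card => u; rewrite !inE cardG.
  by have := deg_lt u; lia.
have LC : ~: L = [set u : G | #|G| - deg u == n + 1]%N.
  (* Vertices of degree n+1 are not low because n > 1; there are two of them, as many as there are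
     vertices outside [L]. *)
  apply/esym/eqP; rewrite eqEcard; apply/andP; split.
    by apply/subsetP => u; rewrite !inE cardG; have := deg_lt u; lia.
  rewrite cnt eqxx; have -> : (n + 1 == 2 * n)%N = false by lia.
  by have := cardsC L; rewrite cardL; lia.
have degL u : u \in L -> deg u = 2 by rewrite inE => /eqP.
have degLC u : u \notin L -> deg u = n.+1.
  by rewrite -in_setC LC inE cardG; have := deg_lt u; lia.
have degP (u : G) : deg u = 2 \/ deg u = n.+1.
  by case: (boolP (u \in L)) => [/degL|/degLC]; auto.
have /eqP/cards2P[a [b [nab defLC]]] : #|~: L| = 2.
  by have := cardsC L; lia.
have [connC fyC] : (forall w : G, connected (induced [set~ w])) /\
                   (forall w : G, fy [set~ w] = (2 * n + 2)%N).
  (* This coefficient counts the [w] with both properties; it equals the number of vertices, so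
     every [w] has them. *)
  have /(congr1 (fun p : {poly int} => p`_(2 * n + 2))) := eq3.
  have -> : (2 * n + 1 = #|G|.-1)%N by lia.
  rewrite coef_pred_da; last by lia.
  rewrite coef_sumXn coefZ coefXn eqxx /= => cN.
  have /setP all_w : [set w : G | connected (induced [set~ w]) &
                         fy [set~ w] == (2 * n + 2)%N] = setT.
    by apply/eqP; rewrite eqEcard subsetT cardsT cardG; lia.
  by split=> w; have := all_w w; rewrite !inE => /andP[? /eqP].
have deltaL_gt0 w : (0 < delta L w)%N.
  have S0 : [set~ w] != set0 by rewrite -cards_eq0 cardsC1; lia.
  (* At a vertex [u] attaining the minimum, [deg u] is twice [adj u w]; as degrees are 2 or n+1 > 2,
     [u] is a low neighbour of [w]. *)
  have [[u uw fu] _] := fyP S0; rewrite fyC fy_at_setC1 cardG in fu.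
  apply/card_gt0P; exists u; rewrite !inE adj_sym.
  by move: fu; case: (degP u) => ->; case: (adj u w); lia.
have deltaL : {in L, forall u, delta L u = 1}.
  have sumL : (\sum_(u in L) delta L u = 2 * n)%N.
    have := coef2_da G; rewrite eq2.
    (* An edge contributes to this power of y exactly when both ends have degree 2, so there are 2n
       ordered pairs of adjacent low vertices. *)
    move/(congr1 (fun p : {poly int} => p`_(2 * n + 2))).
    rewrite coef_sumXn coefMn coefD !coefZ !coefXn eqxx.
    have -> : (2 * n + 2 == n + 3)%N = false by lia.
    move=> cE; transitivity #|[set e : G * G | adj e.1 e.2 &
       (#|G| + 2 - maxn (deg e.1) (deg e.2) == 2 * n + 2)%N]|; last first.
      apply/eqP; rewrite -(Num.Theory.eqr_nat int) -cE; apply/eqP.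
      by rewrite mulr1 mulr0 addr0 -mulrnA mulnC.
    rewrite -sum1_card (eq_bigl (fun e : G * G =>
      (e.1 \in L) && ((e.2 \in L) && adj e.1 e.2))); last first.
      move=> [u v]; rewrite !inE /= cardG.
      by case: (degP u) => ->; case: (degP v) => ->; case: (adj u v); lia.
    rewrite -(pair_big_dep (fun u => u \in L)
      (fun u v => (v \in L) && adj u v) (fun _ _ => 1%N)) /=.
    apply: eq_bigr => u _; rewrite sum1_card.
    by rewrite /delta cardsE.
  (* The 2n values [delta L u] are at least 1 and sum to 2n, hence all equal 1. *)
  have /leqif_sum[_] : forall u, u \in L -> (1 <= delta L u ?= iff (1 == delta L u))%N.
    by move=> u _; split.
  rewrite sumL sum1_card cardL eqxx => /esym/forall_inP alleq u uL.
  by rewrite -(eqP (alleq u uL)).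
pose h (s : bool) := if s then a else b.
apply: (isomorphic_book (L := L) (h := h)) => //.
- by move=> [] [] //= e; rewrite e eqxx in nab.
- by move=> s; apply: degLC; rewrite -in_setC defLC !inE; case: s; rewrite eqxx ?orbT.
Qed.
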